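(* Let $\mathcal A$ be a real Banach space and $\mathcal B=\mathcal A'$ its dual, with weak\* topology $w^*$. Let $\Theta$ be a parameter set, $\theta\mapsto f_\theta\in\mathcal B$ a parametric model, $C:\Theta\to[0,+\infty)$ a parameter cost, $R_\Theta:\mathcal B\to[0,+\infty]$ the parametric representation cost, and $R$ its $w^*$-l.s.c. regularization. Let $\mathcal U$ be the $w^*$-closure of $\mathcal U_\Theta:=\{f\in\mathcal B:R_\Theta(f)\le1\}$. If $R_\Theta$ is absolutely $p$-homogeneous for some $p>0$, then $$R(f)^{1/p}=G_{\mathcal U}(f),\qquad f\in\mathcal B,$$ where $G_{\mathcal U}(f):=\inf\{\lambda>0: f/\lambda\in\mathcal U\}$ is the gauge of $\mathcal U$.
   Context: $w^*=\sigma(\mathcal B,\mathcal A)$. $\mathcal F_\Theta=\{f_\theta:\theta\in\Theta\}$. $R_\Theta(f)=\inf\{C(\theta):\theta\in\Theta,\ f_\theta=f\}$ for $f\in\mathcal F_\Theta$ and $R_\Theta(f)=+\infty$ for $f\in\mathcal B\setminus\mathcal F_\Theta$. A function $K:\mathcal B\to[-\infty,+\infty]$ is $w^*$-l.s.c. if all sublevel sets $\{K\le\alpha\}$, $\alpha\in\mathbb R$, are $w^*$-closed; its $w^*$-l.s.c. regularization is the largest $w^*$-l.s.c. function bounded above by $K$. $K:\mathcal B\to[0,+\infty]$ is absolutely $p$-homogeneous if $K(0)=0$ and $K(\alpha f)=|\alpha|^pK(f)$ for all $\alpha\in\mathbb R\setminus\{0\}$, $f\in\mathcal B$. Convention: $\inf\varnothing=+\infty$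 and $(+\infty)^{1/p}=+\infty$. *)

(* Defs.v *)
From HB Require Import structures.
From mathcomp Require Import all_boot all_order all_algebra.
From mathcomp Require Import all_classical all_reals all_analysis.

Set Implicit Arguments.
Unset Strict Implicit.
Unset Printing Implicit Defensive.
Import Order.TTheory GRing.Theory Num.Theory.
Import numFieldNormedType.Exports.

Local Open Scope classical_set_scope.
Local Open Scope ring_scope.

Section dual.
Context {R : realType} (A : normedModType R).

Definition is_dual : {pred (A -> R^o)} :=
  mem [set f : A -> R^o | linear f /\ continuous f].

Lemma is_dual_submod_closed : submod_closed is_dual.
Proof.
split=> [|a f g].
  rewrite inE; split; last exact: cst_continuous.
  by move=> k x y /=; rewrite scaler0 addr0.
rewrite !inE => -[lf cf] [lg cg]; split=> [k x y|x].
  have fgE z : (a *: f + g) z = a *: f z + g z by [].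
  rewrite !fgE lf lg !scalerDr !scalerA (mulrC a k).
  by rewrite !addrA; congr (_ + _); rewrite -!addrA; congr (_ + _); rewrite addrC.
by apply: continuousD; [exact: (cvgZl_tmp (cf x))|exact: cg].
Qed.

HB.instance Definition _ :=
  GRing.isSubmodClosed.Build R (A -> R^o) is_dual is_dual_submod_closed.

Record dual := Dual { dual_fun :> A -> R^o; dual_funP : dual_fun \in is_dual }.

HB.instance Definition _ := [isSub for dual_fun].
HB.instance Definition _ := [Choice of dual by <:].
HB.instance Definition _ := [SubChoice_isSubLmodule of dual by <:].

(* The only topology put on the dual is the weak* one, the coarsest making
   every evaluation f |-> f x continuous: it is induced by the product topology
   on A -> R. *)
HB.instance Definition _ := Topological.copy dual
  (initial_topology (dual_fun : dual -> {ptws A -> R^o})).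

End dual.

Arguments dual {R} A.

Section rep_cost.
Context {R : realType} {A : normedModType R} {Theta : Type}.
Local Open Scope ereal_scope.

Definition rep_cost (f_ : Theta -> dual A) (C : Theta -> R) (f : dual A) :
    \bar R :=
  ereal_inf [set (C t)%:E | t in [set t | f_ t = f]].

Lemma rep_cost_out (f_ : Theta -> dual A) (C : Theta -> R) (f : dual A) :
  ~ range f_ f -> rep_cost f_ C f = +oo.
Proof.
move=> nf; rewrite /rep_cost (_ : [set t | f_ t = f] = set0).
  by rewrite image_set0 ereal_inf0.
by apply/seteqP; split=> // t /= tf; apply: nf; exists t.
Qed.

End rep_cost.

Section lsc.
Context {R : realType} {T : topologicalType}.
Implicit Types K L : T -> \bar R.
Local Open Scope ereal_scope.

Definition lsc K := forall a : R, closed [set x | K x <= a%:E].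

Lemma lscP K : lsc K <-> lower_semicontinuous K.
Proof.
rewrite lower_semicontinuousP; split=> H a; have := H a.
  rewrite -openC (_ : ~` _ = [set x | a%:E < K x])//.
  by apply/seteqP; split=> x /=; [move/negP; rewrite -ltNge|rewrite ltNge => /negP].
rewrite -closedC (_ : ~` _ = [set x | K x <= a%:E])//.
by apply/seteqP; split=> x /=; [move/negP; rewrite -leNgt|rewrite leNgt => /negP].
Qed.

Definition is_lsc_regularization K L :=
  [/\ lsc L, forall x, L x <= K x &
      forall M, lsc M -> (forall x, M x <= K x) -> forall x, M x <= L x].

Lemma lsc_regularization_unique K L L' :
  is_lsc_regularization K L -> is_lsc_regularization K L' -> L = L'.
Proof.
move=> [cL leL maxL] [cL' leL' maxL']; apply/funext => x; apply/eqP.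
by rewrite eq_le maxL// maxL'.
Qed.

Lemma lsc_regularization_exists K : exists L, is_lsc_regularization K L.
Proof.
exists (fun x => ereal_sup [set M x | M in
  [set M | lsc M /\ forall y, M y <= K y]]); split.
- move=> a; rewrite (_ : [set x | _] = \bigcap_(M in
    [set M | lsc M /\ forall y, M y <= K y]) [set x | M x <= a%:E]).
    by apply: closed_bigI => M [cM _]; exact: cM.
  apply/seteqP; split=> x /=.
    move=> supa M HM /=; apply: le_trans supa.
    by apply: ereal_sup_ubound; exists M.
  by move=> H; apply: ge_ereal_sup => _ [M HM <-]; exact: H.
- by move=> x; apply: ge_ereal_sup => _ [M [_ MK] <-]; exact: MK.
- by move=> M cM MK x; apply: ereal_sup_ubound; exists M.
Qed.

End lsc.

Section homogeneous_gauge.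
Context {R : realType} {V : lmodType R}.
Local Open Scope ereal_scope.

Definition abs_homogeneous (p : R) (K : V -> \bar R) :=
  K 0%R = 0 /\
  forall (a : R) (f : V), a != 0%R -> K (a *: f)%R = (`|a| `^ p)%:E * K f.

Definition gauge (U : set V) (f : V) : \bar R :=
  ereal_inf [set l%:E | l in [set l : R | (0 < l)%R /\ U (l^-1 *: f)%R]].

End homogeneous_gauge.

(* Main.v *)
Require Import Defs.
From mathcomp Require Import all_boot all_order all_algebra.
From mathcomp Require Import all_classical all_reals all_analysis.
Import Order.TTheory GRing.Theory Num.Theory.
Import numFieldNormedType.Exports.

Local Open Scope classical_set_scope.
Local Open Scope ring_scope.

(** Write [K] for the representation cost. For [l > 0], homogeneity gives
    [K (l^-1 f) <= 1 <-> K f <= l^p], so the dilates of the unit sublevel set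
    are the sublevel sets of [K]. As dilations are weak* continuous and [U] is
    closed and star-shaped, [{G_U <= a}] is the intersection of the closed sets
    [b U] over [b > a]; hence [G_U^p] is a lower semicontinuous minorant of [K],
    and [G_U^p <= R]. Conversely, [f / l \in U] puts [f] in the closure of
    [{K <= l^p}], which is contained in the closed set [{R <= l^p}]. *)

Lemma dual_eval_continuous (R : realType) (A : normedModType R) (x : A) :
  continuous (fun f : dual A => f x : R^o).
Proof.
move=> f.
apply: (@continuous_comp _ _ _ (@dual_fun R A : dual A -> {ptws A -> R^o})
  (@proj A (fun=> R^o) x)); [exact: initial_continuous|exact: proj_continuous].
Qed.

(** Weak* continuity is tested on evaluations: for each [x], the coordinate [f |-> a *: f x] is a
    scalar multiple of a continuous one. *)
Lemma dual_scale_continuous (R : realType) (A : normedModType R) (a : R) :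
  continuous (fun f : dual A => a *: f).
Proof.
apply: (@continuous_comp_initial _ _ _
  (@dual_fun R A : dual A -> {ptws A -> R^o})).
move=> f; apply/cvg_sup => [|x]; first exact/fmap_filter/nbhs_filter.
move: f.
apply: (@continuous_comp_initial _ _ _ (fun g : A -> R^o => g x)) => f.
exact: (cvgZl_tmp (@dual_eval_continuous R A x f)).
Qed.

Lemma closure_sub_closed (T : topologicalType) (S D : set T) :
  closed D -> S `<=` D -> closure S `<=` D.
Proof. by move=> /closure_id {2}-> /closure_subset. Qed.

Lemma closed_dual_scale_preimage (R : realType) (A : normedModType R) (a : R)
    (U : set (dual A)) :
  closed U -> closed [set f | U (a *: f)].
Proof.
by move=> cU; have /continuous_closedP := dual_scale_continuous R A a; apply.
Qed.

Section power.
Context {R : realType}.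
Local Open Scope ereal_scope.

Lemma poweRK (p : R) (x : \bar R) : p != 0%R -> 0 <= x ->
  (x `^ p) `^ p^-1 = x.
Proof. by move=> p0 x0; rewrite -poweRrM mulfV// poweRe1. Qed.

Lemma poweRVK (p : R) (x : \bar R) : p != 0%R -> 0 <= x ->
  (x `^ p^-1) `^ p = x.
Proof. by move=> p0 x0; rewrite -poweRrM mulVf// poweRe1. Qed.

Lemma le_poweR (p : R) (x y : \bar R) : (0 < p)%R -> 0 <= x -> x <= y ->
  x `^ p <= y `^ p.
Proof.
move=> p0 x0 xy; apply: gt0_ler_poweR => //; rewrite ?ltW//
  in_itv/= leey andbT//.
exact: le_trans xy.
Qed.

(** The powers [p] and [p^-1] are increasing and mutually inverse on [0, +oo], the infinite endpoint
    included. *)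
Lemma le_poweR_V (p : R) (x y : \bar R) : (0 < p)%R -> 0 <= x -> 0 <= y ->
  (x `^ p <= y) = (x <= y `^ p^-1).
Proof.
move=> p0 x0 y0; apply/idP/idP => H.
  rewrite -(@poweRK p x) ?gt_eqF//.
  by apply: le_poweR; rewrite ?invr_gt0 ?poweR_ge0.
by rewrite -(@poweRVK p y) ?gt_eqF//; exact: le_poweR.
Qed.

End power.

Section gauge.
Context {R : realType}.
Local Open Scope ereal_scope.

Lemma abs_homogeneous_sublevel (V : lmodType R) (p : R) (K : V -> \bar R)
    (l : R) (f : V) : abs_homogeneous p K -> (0 < l)%R ->
  (K (l^-1 *: f)%R <= 1) = (K f <= (l `^ p)%:E).
Proof.
move=> [_ homK] l0; rewrite homK ?invr_neq0 ?gt_eqF// gtr0_norm ?invr_gt0//.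
have -> : (l^-1 `^ p = (l `^ p)^-1)%R.
  by rewrite -powR_inv1 ?ltW// -powRrM mulN1r powRN.
by rewrite lee_pdivrMl ?powR_gt0// mule1.
Qed.

Lemma gauge_ge0 (V : lmodType R) (U : set V) (f : V) : 0 <= gauge U f.
Proof. by apply/ereal_infP => _ [l [l0 _] <-]; rewrite lee_fin ltW. Qed.

(** Star-shapedness makes the set of admissible factors upward closed, so every [b] above the
    infimum is admissible. The inequality [a < b] is strict because the infimum need not be
    attained; it also keeps [b] positive when [a = 0]. *)
Lemma gauge_leP (V : lmodType R) (U : set V) (a : R) (f : V) :
  (forall (t : R) g, (0 < t <= 1)%R -> U g -> U (t *: g)%R) -> (0 <= a)%R ->
  gauge U f <= a%:E <-> forall b : R, (a < b)%R -> U (b^-1 *: f)%R.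
Proof.
move=> starU a0; split=> [Ufa b ab|Uf].
  have /ereal_inf_lt[_ [l [l0 Ul] <-]] : gauge U f < b%:E.
    by apply: le_lt_trans Ufa _; rewrite lte_fin.
  rewrite lte_fin => lb; have b0 := lt_trans l0 lb.
  have -> : (b^-1 *: f = (l / b) *: (l^-1 *: f))%R.
    by rewrite scalerA mulrAC mulfV ?mul1r// gt_eqF.
  by apply: starU => //; rewrite divr_gt0//= ler_pdivrMr// mul1r ltW.
apply/lee_addgt0Pr => e e0; apply: ereal_inf_lbound; exists (a + e)%R => //.
by split; [rewrite ltr_wpDl|apply: Uf; rewrite ltrDl].
Qed.

Lemma lsc_gauge (A : normedModType R) (p : R) (U : set (dual A)) :
  (0 < p)%R -> closed U ->
  (forall (t : R) g, (0 < t <= 1)%R -> U g -> U (t *: g)%R) ->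
  lsc (fun f => gauge U f `^ p).
Proof.
move=> p0 cU starU a; have [a0|a0] := ltP a 0%R.
  rewrite (_ : mkset _ = set0); first exact: closed0.
  apply/seteqP; split=> f //= /(le_trans (poweR_ge0 _ _)).
  by rewrite lee_fin leNgt a0.
(* The sublevel set of the [p]-th power at [a] is that of the gauge at a^(1/p). *)
rewrite (_ : mkset _ = \bigcap_(b in [set b | (a `^ p^-1 < b)%R])
    [set f | U (b^-1 *: f)%R]).
  by apply: closed_bigI => b _; exact: closed_dual_scale_preimage.
apply/seteqP; split=> f /=;
  rewrite le_poweR_V ?gauge_ge0 ?lee_fin// poweR_EFin.
  by move=> /gauge_leP H b /=; apply: H => //; exact: powR_ge0.
by move=> H; apply/gauge_leP => //; exact: powR_ge0.
Qed.

End gauge.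

(** For fixed [t], the points [h] with [t *: h] in [closure S] form a closed set containing [S]. *)
Lemma closure_star_shaped (R : realType) (A : normedModType R)
    (S : set (dual A)) :
  (forall (t : R) g, 0 < t <= 1 -> S g -> S (t *: g)) ->
  forall (t : R) g, 0 < t <= 1 -> closure S g -> closure S (t *: g).
Proof.
move=> starS t g t01.
apply: (@closure_sub_closed _ _ [set h | closure S (t *: h)]).
  exact: (closed_dual_scale_preimage _ _ _ _ (@closed_closure _ S)).
by move=> h Sh; apply/subset_closure/starS.
Qed.

Lemma lsc_regularization_gauge (R : realType) (A : normedModType R)
    (K L : dual A -> \bar R) (p : R) :
  0 < p -> (forall f, 0 <= K f)%E -> abs_homogeneous p K ->
  is_lsc_regularization K L ->
  forall f, ((L f) `^ p^-1)%E = gauge (closure [set g | K g <= 1]%E) f.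
Proof.
move=> p0 K0 homK [lscL LK maxL] f; set U := closure _.
(* The constant 0 is a lower semicontinuous minorant of [K], so it lies below [L]. *)
have L0 : (0 <= L f)%E.
  apply: (maxL (cst 0%E)) => // a; have [a0|a0] := leP 0 a.
    rewrite (_ : mkset _ = setT); first exact: closedT.
    by apply/seteqP; split=> // x _ /=; rewrite lee_fin.
  rewrite (_ : mkset _ = set0); first exact: closed0.
  by apply/seteqP; split=> // x /=; rewrite lee_fin leNgt a0.
have starS (t : R) g : 0 < t <= 1 -> (K g <= 1)%E -> (K (t *: g) <= 1)%E.
  (* Shrinking by [t] is division by [l = t^-1 >= 1], for which 1 <= l^p. *)
  move=> /andP[t0 t1] Kg; rewrite -[t]invrK.
  rewrite (abs_homogeneous_sublevel _ _ _ _ _ homK) ?invr_gt0//.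
  apply: (le_trans Kg); rewrite lee_fin.
  have -> : 1 = 1 `^ p :> R by rewrite powR1.
  by apply: ge0_ler_powR; rewrite ?nnegrE ?invr_ge0 ?(ltW t0) ?(ltW p0)//
    invf_ge1.
have starU := closure_star_shaped _ _ _ starS.
apply/eqP; rewrite eq_le; apply/andP; split.
  apply/ereal_infP => _ [l [l0 Ulf] <-].
  suff Lf : (L f <= (l `^ p)%:E)%E.
    rewrite -[leRHS](@poweRK _ p) ?gt_eqF ?lee_fin ?(ltW l0)//.
    by apply: le_poweR; rewrite ?invr_gt0 ?poweR_EFin.
  (* The bound passes to the closure through the closed set of all [g] with L(l g) <= l^p: where
     [K g <= 1], homogeneity gives L(l g) <= K(l g) <= l^p. *)
  have -> : f = l *: (l^-1 *: f) by rewrite scalerA mulfV ?scale1r ?gt_eqF.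
  apply: (@closure_sub_closed _ _ [set g | L (l *: g) <= (l `^ p)%:E]%E) Ulf.
    exact: (closed_dual_scale_preimage _ _ _ _ (lscL _)).
  move=> g /= Kg; apply: le_trans (LK _) _.
  by rewrite -(abs_homogeneous_sublevel _ _ _ _ _ homK)//
    scalerA mulVf ?scale1r ?gt_eqF.
(* The reverse inequality is the maximality of [L], tested on the [p]-th power of the gauge. *)
rewrite -le_poweR_V ?gauge_ge0//; apply: (maxL (fun g => (gauge U g `^ p)%E)).
  by apply: lsc_gauge => //; exact: closed_closure.
move=> g; rewrite le_poweR_V ?gauge_ge0//.
have := K0 g; case Kg : (K g) => [k| |] //; last first.
  by rewrite poweRyr ?leey// invr_neq0 ?gt_eqF.
rewrite lee_fin => k0; rewrite poweR_EFin.
apply/gauge_leP => //; first exact: powR_ge0.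
(* Since b > k^(1/p) gives k <= b^p, the point [b^-1 *: g] is already in the unit sublevel set of
   [K], before taking the closure. *)
move=> b kb; apply: subset_closure => /=.
have b0 : 0 < b by apply: le_lt_trans kb; exact: powR_ge0.
rewrite (abs_homogeneous_sublevel _ _ _ _ _ homK)// Kg -poweR_EFin.
rewrite -[leLHS](@poweRVK _ p) ?gt_eqF//.
by apply: le_poweR; rewrite ?poweR_ge0// poweR_EFin lee_fin ltW.
Qed.

Theorem theorem3p2 (R : realType) (A : completeNormedModType R)
    (Theta : Type) (f_ : Theta -> dual A) (C : Theta -> R)
    (C_ge0 : forall t, 0 <= C t)
    (Rlsc : dual A -> \bar R)
    (Rlsc_reg : is_lsc_regularization (rep_cost f_ C) Rlsc)
    (p : R) (p_gt0 : 0 < p)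
    (homR : abs_homogeneous p (rep_cost f_ C)) :
  forall f : dual A,
    ((Rlsc f) `^ p^-1)%E =
    gauge (closure [set g : dual A | (rep_cost f_ C g <= 1)%E]) f.
Proof.
apply: lsc_regularization_gauge => // f.
by apply/ereal_infP => _ [t _ <-]; rewrite lee_fin.
Qed.
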